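(* Let $\phi$ and $\psi$ be propositional formulas. If $\phi$ is $\mathrm{N}$-valid and $\phi \rightarrow \psi$ is $\mathrm{N}$-valid, then $\psi$ is $\mathrm{N}$-valid.
   Context: Formulas are built from a fixed nonempty set of atoms using $\neg,\vee,\wedge,\rightarrow$. There are three symbolic attack expressions $?$, $\wedge_L$, $\wedge_R$, distinct from all formulas and connectives. A statement is a formula or a symbolic attack. The two players are $P$ (Proponent) and $O$ (Opponent). A signed expression is a pair $\langle A,e\rangle$ with $A\in\{P,O\}$ and $e$ a statement. Particle rules: $\alpha\wedge\beta$ may be attacked by $\wedge_L$ (response: $\alpha$) or by $\wedge_R$ (response: $\beta$); $\alpha\vee\beta$ is attacked by $?$ (response: $\alpha$ or $\beta$, at the defender's choice); $\alpha\rightarrow\beta$ is attacked by asserting $\alpha$ (response: $\beta$); $\neg\alpha$ is attacked by asserting $\alpha$ (there is no response). A dialogue commencing with $\phi$ is a pair $(\delta,\eta)$, where $\delta$ is a nonempty finite or infinite ($\omega$-indexed) sequence of signed expressions with $\delta(0)=\langle P,\phi\rangle$, and $\eta$ is a function with domain $\operatorname{dom}(\delta)\setminus\{0\}$ such that each $\eta(n)$ is a pair $[m,Z]$ with $m<n$ a natural number and $Z\in\{A,D\}$ ($A$ = attack, $D$ = defend), subject to: (1) $\delta(n)$ is $P$-signed if $n$ is even and $O$-signed if $n$ is odd; (2) if $\eta(n)=[m,A]$, then $\delta(m)$ was asserted by the other player (i.e. $n-m$ is odd), is a non-atomic formula, and $\delta(n)$ is an attack upon $\delta(m)$ according to the particle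 rules; (3) if $\eta(n)=[m,D]$, then $n-m$ is odd, $\eta(m)=[k,A]$ for some $k$, and $\delta(n)$ is a response, according to the particle rules, to the attack $\delta(m)$ upon $\delta(k)$. An $\mathrm{N}$-dialogue is a dialogue satisfying the two structural rules: ($\mathrm{D10}$) if $\delta(n)=\langle P,a\rangle$ with $a$ atomic, then there is $m<n$ with $\delta(m)=\langle O,a\rangle$ (this applies also to $n=0$); ($\mathrm{D13}$) if $m$ is even, there is at most one $n$ with $\eta(n)=[m,A]$. The $\mathrm{N}$-dialogue tree $T_\phi$ is the rooted tree of all $\mathrm{N}$-dialogues commencing with $\phi$: its nodes are the moves (the nodes at depth $n$ correspond to the $\mathrm{N}$-dialogues with domain $[0,n]$), children are one-move extensions, and a branch is a maximal chain containing the root. $P$ wins an $\mathrm{N}$-dialogue if its domain is $[0,2k]$ for some $k\in\mathbb{N}$ and it has no proper extension to an $\mathrm{N}$-dialogue. An $\mathrm{N}$-winning strategy (for $P$) for $\phi$ is a rooted subtree $s$ of $T_\phi$, with the same root, such that: every branch of $s$ is an $\mathrm{N}$-dialogue won by $P$; every node of $s$ at odd depth has exactly one child in $s$; every node of $s$ at even depth has the same children in $s$ as in $T_\phi$. A formula $\phi$ is $\mathrm{N}$-valid if there is an $\mathrm{N}$-winning strategy for $\phi$. *)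

(* Defs.v *)
From mathcomp Require Import all_boot.
Set Implicit Arguments.
Unset Strict Implicit.
Unset Printing Implicit Defensive.

Inductive formula (atom : Type) : Type :=
| Atom of atom
| Neg of formula atom
| Or of formula atom & formula atom
| And of formula atom & formula atom
| Imp of formula atom & formula atom.
Arguments Atom {atom} _.

Inductive symbolic_attack : Type := AskOr | AskAndL | AskAndR.

Inductive statement (atom : Type) : Type :=
| Form of formula atom
| Symbolic of symbolic_attack.
Arguments Symbolic {atom} _.

Inductive player : Type := Proponent | Opponent.

Definition signed_expr (atom : Type) : Type := (player * statement atom)%type.

Inductive stance : Type := Attack | Defend.

Definition is_atomic (atom : Type) (f : formula atom) : Prop :=
  exists a, f = Atom a.

Inductive attack (atom : Type) : formula atom -> statement atom -> Prop :=
| attack_andL f g : attack (And f g) (Symbolic AskAndL)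
| attack_andR f g : attack (And f g) (Symbolic AskAndR)
| attack_or f g : attack (Or f g) (Symbolic AskOr)
| attack_imp f g : attack (Imp f g) (Form f)
| attack_neg f : attack (Neg f) (Form f).

(* [response f e r]: the statement [r] is a response to the attack [e] upon
   [f]. There is no constructor for [Neg]. *)
Inductive response (atom : Type) :
  formula atom -> statement atom -> statement atom -> Prop :=
| response_andL f g : response (And f g) (Symbolic AskAndL) (Form f)
| response_andR f g : response (And f g) (Symbolic AskAndR) (Form g)
| response_orL f g : response (Or f g) (Symbolic AskOr) (Form f)
| response_orR f g : response (Or f g) (Symbolic AskOr) (Form g)
| response_imp f g : response (Imp f g) (Form f) (Form g).

(* A move packs delta(n) with eta(n); [reference] is [None] exactly at the
   opening move, where eta is undefined. *)
Record move (atom : Type) : Type := Move {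
  expression : signed_expr atom;
  reference : option (nat * stance) }.

Inductive play (atom : Type) : Type :=
| FinitePlay of seq (move atom)
| InfinitePlay of (nat -> move atom).

Definition move_at (atom : Type) (d : play atom) (n : nat) :
    option (move atom) :=
  match d with
  | FinitePlay l => onth l n
  | InfinitePlay f => Some (f n)
  end.

Definition dom (atom : Type) (d : play atom) (n : nat) : bool :=
  isSome (move_at d n).

Definition delta (atom : Type) (d : play atom) (n : nat) :
    option (signed_expr atom) :=
  omap (@expression atom) (move_at d n).

Definition eta (atom : Type) (d : play atom) (n : nat) :
    option (nat * stance) :=
  obind (@reference atom) (move_at d n).

Record dialogue (atom : Type) (phi : formula atom) (d : play atom) : Prop := {
  dialogue_opening : delta d 0 = Some (Proponent, Form phi);
  dialogue_eta0 : eta d 0 = None;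
  dialogue_eta : forall n, 0 < n -> dom d n ->
    exists m Z, eta d n = Some (m, Z) /\ m < n;
  dialogue_turns : forall n A e, delta d n = Some (A, e) ->
    A = if odd n then Opponent else Proponent;
  dialogue_attack : forall n m, eta d n = Some (m, Attack) ->
    odd (n - m) /\
    exists A B f e,
      [/\ delta d m = Some (A, Form f), ~ is_atomic f,
          delta d n = Some (B, e) & attack f e];
  dialogue_defend : forall n m, eta d n = Some (m, Defend) ->
    odd (n - m) /\
    exists k, eta d m = Some (k, Attack) /\
    exists A B C f e r,
      [/\ delta d k = Some (A, Form f), delta d m = Some (B, e),
          delta d n = Some (C, r) & response f e r] }.

Definition D10 (atom : Type) (d : play atom) : Prop :=
  forall n a, delta d n = Some (Proponent, Form (Atom a)) ->
    exists m, m < n /\ delta d m = Some (Opponent, Form (Atom a)).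

Definition D13 (atom : Type) (d : play atom) : Prop :=
  forall m n n', ~~ odd m ->
    eta d n = Some (m, Attack) -> eta d n' = Some (m, Attack) -> n = n'.

Definition N_dialogue (atom : Type) (phi : formula atom) (d : play atom) :
    Prop :=
  [/\ dialogue phi d, D10 d & D13 d].

Definition extends (atom : Type) (d d' : play atom) : Prop :=
  forall n x, move_at d n = Some x -> move_at d' n = Some x.

Definition proper_extends (atom : Type) (d d' : play atom) : Prop :=
  extends d d' /\ ~ extends d' d.

Definition P_wins (atom : Type) (phi : formula atom) (d : play atom) : Prop :=
  [/\ N_dialogue phi d,
      exists k, forall n, dom d n = (n <= k.*2) &
      ~ exists d', N_dialogue phi d' /\ proper_extends d d'].

(* A node of the tree at depth n is identified with the N-dialogue with domain
   [0,n] that leads to it, i.e. with a list of n+1 moves. *)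
Definition node (atom : Type) (phi : formula atom) (l : seq (move atom)) :
    Prop :=
  N_dialogue phi (FinitePlay l).

Definition depth (atom : Type) (l : seq (move atom)) : nat := (size l).-1.

Definition root_node (atom : Type) (phi : formula atom) : seq (move atom) :=
  [:: Move (Proponent, Form phi) None].

Definition child (atom : Type) (l l' : seq (move atom)) : Prop :=
  exists x, l' = rcons l x.

Record rooted_subtree (atom : Type) (phi : formula atom)
    (s : seq (move atom) -> Prop) : Prop := {
  subtree_root : s (root_node phi);
  subtree_node : forall l, s l -> node phi l;
  subtree_closed : forall l l', node phi l -> child l l' -> s l' -> s l }.

Definition chain (atom : Type) (phi : formula atom)
    (s b : seq (move atom) -> Prop) : Prop :=
  [/\ forall l, b l -> s l,
      b (root_node phi) &
      forall l l', b l -> b l' ->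
        extends (FinitePlay l) (FinitePlay l') \/
        extends (FinitePlay l') (FinitePlay l)].

Definition branch (atom : Type) (phi : formula atom)
    (s b : seq (move atom) -> Prop) : Prop :=
  chain phi s b /\
  forall b', chain phi s b' -> (forall l, b l -> b' l) -> forall l, b' l -> b l.

(* A branch [b] is identified with the (finite or infinite) play [d] whose
   nonempty finite initial segments are exactly the nodes on [b]. *)
Definition branch_play (atom : Type) (b : seq (move atom) -> Prop)
    (d : play atom) : Prop :=
  forall l, b l <-> 0 < size l /\ extends (FinitePlay l) d.

Record N_winning_strategy (atom : Type) (phi : formula atom)
    (s : seq (move atom) -> Prop) : Prop := {
  strategy_subtree : rooted_subtree phi s;
  strategy_branches : forall b, branch phi s b ->
    exists d, branch_play b d /\ P_wins phi d;
  strategy_odd : forall l, s l -> odd (depth l) ->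
    exists! l', child l l' /\ s l';
  strategy_even : forall l, s l -> ~~ odd (depth l) ->
    forall l', child l l' -> (s l' <-> node phi l') }.

Definition N_valid (atom : Type) (phi : formula atom) : Prop :=
  exists s, N_winning_strategy phi s.

(* Main.v *)
Require Import Defs.
From mathcomp Require Import all_boot zify.
From Stdlib Require Import Classical IndefiniteDescription.
Set Implicit Arguments.
Unset Strict Implicit.
Unset Printing Implicit Defensive.

(** Nothing stops O from answering the same attack again and again, while a
winning strategy only has finite branches.  So a winning P never makes an
attack that has an answer: P attacks negations only
([strategy_no_answerable_attack]), and O, having nothing to answer, can only
attack.  As each assertion of P is attacked at most once, O always has to
attack the assertion that P has just made.

What remains is a simple game.  A position in which P has to move is described
by the set [G] of the formulas that O has asserted and the set [D] of the
formulas by which P may answer some attack of O; P may then assert any member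
of [D], and any [f] such that [Neg f] is in [G].  Both sets only grow.  The
inductive predicate [win G D] says that P wins from there, [derivable phi]
that P wins after asserting [phi], and [valid_derivable] and
[derivable_valid] show that N-validity is the same as derivability.

In this game modus ponens is easy.  An assertion of O is of use to P only as
an atom that P may copy, or as a negation that P may attack.  By induction on
the formula, a derivable formula is [inert]: it is compound but not a
negation, or the double negation of an inert formula.  A derivable [phi] is
therefore worthless to P when O asserts it.  Now O attacks [Imp phi psi] by
asserting [phi], after which P has [psi] as the only answer; removing the
inert [phi] leaves P winning with [psi] alone ([derivable_mp]). *)

Section N_dialogues.
Variable atom : Type.
Implicit Types (phi psi f g h : formula atom) (e r c : statement atom).
Implicit Types (G D : formula atom -> Prop).
Implicit Types (l t : seq (move atom)) (x y : move atom) (d : play atom).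
Implicit Types (s b : seq (move atom) -> Prop).
Implicit Types (reply : seq (move atom) -> move atom).

(** * The assertion game *)

Definition available G D f : Prop := D f \/ G (Neg f).

(** The clause on atoms is rule D10.  An atom has no attack, so asserting one
wins at once: this is the base case. *)
Inductive win G D : Prop :=
| win_assert f :
    available G D f ->
    (forall a, f = Atom a -> G f) ->
    (forall e, attack f e ->
       win (fun g => G g \/ e = Form g)
           (fun g => D g \/ response f e (Form g))) ->
    win G D.

(** The opening formula is not an answer to anything and P cannot repeat it;
hence it is not put in the stock of answers, although by [derivable_win] it
could be. *)
Definition derivable phi : Prop :=
  ~ is_atomic phi /\
  forall e, attack phi e ->
    win (fun g => e = Form g) (fun g => response phi e (Form g)).

(** Asserting [f] can bring P nothing beyond the sets [G] and [D] if O has an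
attack [e] on it that hands P only atoms of [G] and formulas that are
themselves available or dispensable. *)
Inductive dispensable G D f : Prop :=
| dispensable_available : available G D f -> dispensable G D f
| dispensable_attack e :
    attack f e ->
    (forall g, response f e (Form g) \/ e = Form (Neg g) ->
       dispensable G D g) ->
    (forall a, e = Form (Atom a) -> G (Atom a)) ->
    dispensable G D f.

Lemma dispensable_sub G D G' D' f :
  (forall g, G g -> G' g) -> (forall g, D g -> D' g) ->
  dispensable G D f -> dispensable G' D' f.
Proof.
move=> sG sD; elim=> {}f => [[/sD|/sG] ? | e fe _ IH sat].
- by left; left.
- by left; right.
- by apply: (dispensable_attack fe IH) => a /sat/sG.
Qed.

(** Whenever the winning play asserts a dispensable formula, let O reply by the
attack that makes it dispensable and skip this round: the position has not
improved for P. *)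
Lemma win_discard G D G' D' :
  win G D ->
  (forall f, available G D f -> dispensable G' D' f) ->
  (forall a, G (Atom a) -> G' (Atom a)) ->
  win G' D'.
Proof.
move=> w; elim: w G' D' => {}G {}D f fav fat _ IH G' D' sub subat.
case: (sub f fav) => [fav'|e fe sube sate].
  apply: (@win_assert _ _ f) => // [a fE | e fe].
    by rewrite fE; apply: subat; rewrite -fE; apply: fat fE.
  set G2 := (X in win X _); set D2 := (X in win _ X).
  have sub2 g : available G D g -> dispensable G2 D2 g.
    by move=> /sub; apply: dispensable_sub => ?; left.
  apply: (IH e fe) => [g [[Dg|rg]|[Gg|eg]] | a [Ga|ea]].
  - by apply: sub2; left.
  - by left; left; right.
  - by apply: sub2; right.
  - by left; right; right.
  - by left; apply: subat.
  - by right.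
apply: (IH e fe) => [g [[Dg|rg]|[Gg|eg]] | a [/subat //|/sate //]].
- by apply: sub; left.
- by apply: sube; left.
- by apply: sub; right.
- by apply: sube; right.
Qed.

Inductive inert : formula atom -> Prop :=
| inert_or f g : inert (Or f g)
| inert_and f g : inert (And f g)
| inert_imp f g : inert (Imp f g)
| inert_negneg f : inert f -> inert (Neg (Neg f)).

Lemma inert_dispensable G D h : inert h -> dispensable G D (Neg h).
Proof.
have neg_dispensable f :
    (forall g, f = Neg g -> dispensable G D g) ->
    ~ is_atomic f -> dispensable G D (Neg f).
  move=> subf Nf; apply: (dispensable_attack (attack_neg f)).
    by move=> g [rg|[/subf //]]; inversion rg.
  by move=> a [fE]; case: Nf; exists a.
by elim=> [f g|f g|f g|f _ dis_f]; apply: neg_dispensable => //;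
  try (by case); move=> g [<-].
Qed.

(** Repeating [f] is of no help: O may attack it in the same way as the first
time, so that [f] is dispensable once it has been attacked. *)
Lemma derivable_win f : win (fun=> False) (eq f) -> derivable f.
Proof.
move=> w; split.
  by case: w => _ [<-|//] at_f _ [a /at_f].
move=> e fe; apply: (win_discard w) => // g [<-|//].
apply: (dispensable_attack fe) => [k|a //].
by case=> [|->]; [left; left | left; right].
Qed.

(** After the attack on [Neg f], P has no answer and can only attack [f], so [f]
must be a negation [Neg g]; then P has no choice but to assert [g], and so [g]
is derivable. *)
Lemma derivable_inert phi : derivable phi -> inert phi.
Proof.
move: phi; fix IH 1 => -[a|[a|f|f g|f g|f g]|f g|f g|f g] [Nphi wphi];
  try by constructor.
- by case: Nphi; exists a.
- have [f [r|//] _ _] := wphi _ (attack_neg _).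
  by inversion r.
- apply/inert_negneg/IH/derivable_win.
  apply: (win_discard (wphi _ (attack_neg _))) => // k [r|[->]].
    by inversion r.
  by left; left.
all: have [k [r|//] _ _] := wphi _ (attack_neg _).
all: by inversion r.
Qed.

Lemma derivable_mp phi psi :
  derivable phi -> derivable (Imp phi psi) -> derivable psi.
Proof.
move=> /derivable_inert in_phi [_ /(_ _ (attack_imp _ _)) w].
apply: derivable_win; apply: (win_discard w) => [f [r|[fE]] | a [fE]].
- by left; left; inversion r.
- by rewrite fE in in_phi; inversion in_phi; apply: inert_dispensable.
- by rewrite fE in in_phi; inversion in_phi.
Qed.

(** * Plays and their initial segments *)

Lemma dom_finite l n : dom (FinitePlay l) n = (n < size l).
Proof. by rewrite /dom /= onthTE. Qed.

Lemma dom_down d n m : m <= n -> dom d n -> dom d m.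
Proof.
by case: d => [l|p] // mn; rewrite !dom_finite; apply: leq_ltn_trans.
Qed.

Lemma delta_dom d n v : delta d n = Some v -> dom d n.
Proof. by rewrite /delta /dom; case: move_at. Qed.

Lemma eta_dom d n v : eta d n = Some v -> dom d n.
Proof. by rewrite /eta /dom; case: move_at. Qed.

Lemma extends_at l d n :
  extends (FinitePlay l) d -> n < size l ->
  move_at (FinitePlay l) n = move_at d n.
Proof.
move=> ext; rewrite -dom_finite /dom.
by case E: move_at => [x|] // _; rewrite (ext _ _ E).
Qed.

Lemma delta_at l d n :
  extends (FinitePlay l) d -> n < size l -> delta (FinitePlay l) n = delta d n.
Proof. by rewrite /delta => ext /(extends_at ext) ->. Qed.

Lemma eta_at l d n :
  extends (FinitePlay l) d -> n < size l -> eta (FinitePlay l) n = eta d n.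
Proof. by rewrite /eta => ext /(extends_at ext) ->. Qed.

Lemma extends_delta d d' n v :
  extends d d' -> delta d n = Some v -> delta d' n = Some v.
Proof.
by rewrite /delta => ext; case E: move_at => [x|] //; rewrite (ext _ _ E).
Qed.

Lemma extends_eta d d' n v :
  extends d d' -> eta d n = Some v -> eta d' n = Some v.
Proof.
by rewrite /eta => ext; case E: move_at => [x|] //; rewrite (ext _ _ E).
Qed.

Lemma extends_cat l l' :
  extends (FinitePlay l) (FinitePlay l') <-> exists t, l' = l ++ t.
Proof.
split=> [ext | [t ->] n x /= ln].
  exists (drop (size l) l'); apply: eq_from_onth => n; rewrite onth_cat.
  case: ltnP => [nl|ln]; first by have /= <- := extends_at ext nl.
  have sll' : size l <= size l'.
    case: l ext {ln} => // x l ext.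
    have := extends_at ext (ltnSn (size l)); rewrite /= => E.
    by rewrite /= -onthTE -E onthTE /=.
  rewrite -[in LHS](cat_take_drop (size l) l') onth_cat.
  by rewrite size_takel // ltnNge ln.
have : n < size l by rewrite -onthTE ln.
by rewrite onth_cat => ->.
Qed.

Lemma extends_rcons l x : extends (FinitePlay l) (FinitePlay (rcons l x)).
Proof. by apply/extends_cat; exists [:: x]; rewrite cats1. Qed.

Lemma extends_trans d1 d2 d3 : extends d1 d2 -> extends d2 d3 -> extends d1 d3.
Proof. by move=> e12 e23 n x /e12/e23. Qed.

Lemma extends_comparable l l' d :
  extends (FinitePlay l) d -> extends (FinitePlay l') d ->
  extends (FinitePlay l) (FinitePlay l') \/
  extends (FinitePlay l') (FinitePlay l).
Proof.
have wlog_le l1 l2 : extends (FinitePlay l1) d -> extends (FinitePlay l2) d ->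
    size l1 <= size l2 -> extends (FinitePlay l1) (FinitePlay l2).
  move=> e1 e2 le12 n x l1n; rewrite (extends_at e2) ?(e1 _ _ l1n) //.
  by apply: leq_trans le12; rewrite -dom_finite /dom l1n.
by move=> el el'; case: (leqP (size l) (size l')) => [?|/ltnW ?];
  [left | right]; apply: wlog_le.
Qed.

Lemma move_at_rcons l x : move_at (FinitePlay (rcons l x)) (size l) = Some x.
Proof. by rewrite /= -cats1 onth_cat ltnn subnn. Qed.

Lemma delta_last l x :
  delta (FinitePlay (rcons l x)) (size l) = Some (expression x).
Proof. by rewrite /delta move_at_rcons. Qed.

Lemma eta_last l x : eta (FinitePlay (rcons l x)) (size l) = reference x.
Proof. by rewrite /eta move_at_rcons. Qed.

Lemma dom_old l x n :
  dom (FinitePlay (rcons l x)) n -> n <> size l -> n < size l.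
Proof. by rewrite dom_finite size_rcons; lia. Qed.

(** All conditions on a move refer to earlier moves only, so that they survive
when the later moves are cut off. *)
Lemma truncated_node phi d l :
  N_dialogue phi d -> 0 < size l -> extends (FinitePlay l) d -> node phi l.
Proof.
move=> [dd d10 d13] l0 ext.
have deltaE := delta_at ext; have etaE := eta_at ext.
have dlt n v : delta (FinitePlay l) n = Some v -> n < size l.
  by move/delta_dom; rewrite dom_finite.
have elt n v : eta (FinitePlay l) n = Some v -> n < size l.
  by move/eta_dom; rewrite dom_finite.
have ref_lt n m Z : eta (FinitePlay l) n = Some (m, Z) -> m < n.
  move=> En; have nl := elt _ _ En; move: En; rewrite etaE // => En.
  case: n nl En => [|n] nl; first by rewrite (dialogue_eta0 dd).
  have [||m' [Z' [-> lt]] [<- _] //] := dialogue_eta dd (n := n.+1) => //.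
  by rewrite /dom -(extends_at ext nl) -/(dom _ _) dom_finite.
split; first split.
- by rewrite deltaE // (dialogue_opening dd).
- by rewrite etaE // (dialogue_eta0 dd).
- move=> n n0; rewrite dom_finite => nl; rewrite etaE //.
  apply: (dialogue_eta dd) => //.
  by rewrite /dom -(extends_at ext nl) -/(dom _ _) dom_finite.
- by move=> n A e /(extends_delta ext); apply: dialogue_turns dd _ _ _.
- move=> n m En; have nl := elt _ _ En; have mn := ref_lt _ _ _ En.
  rewrite !deltaE //; last exact: ltn_trans nl.
  by move/(extends_eta ext): En; apply: dialogue_attack dd _ _.
- move=> n m En; have nl := elt _ _ En; have mn := ref_lt _ _ _ En.
  have ml := ltn_trans mn nl; rewrite etaE //.
  move/(extends_eta ext): En => /(dialogue_defend dd)[-> [k [Em H]]].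
  split=> //; exists k; split=> //.
  have km : k < m by apply: (ref_lt _ _ Attack); rewrite etaE.
  by rewrite !deltaE //; apply: ltn_trans ml.
- move=> n a /[dup]/dlt nl /(extends_delta ext)/d10[m [mn Dm]].
  by exists m; rewrite deltaE //; apply: ltn_trans nl.
- move=> m n n' em /(extends_eta ext) En /(extends_eta ext).
  exact: d13 em En.
Qed.

Lemma node_size phi l : node phi l -> 0 < size l.
Proof. by case=> -[/delta_dom]; rewrite dom_finite. Qed.

Lemma node_root phi l : node phi l -> exists t, l = root_node phi ++ t.
Proof.
case=> -[+ + _ _ _ _] _ _; case: l => // -[e r] l.
by rewrite /delta /eta /= => -[->] ->; exists l.
Qed.

Lemma node_ref phi l n m Z :
  node phi l -> eta (FinitePlay l) n = Some (m, Z) -> m < n.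
Proof.
move=> [dd _ _] En; case: n En => [|n] En.
  by rewrite (dialogue_eta0 dd) in En.
by have [||m' [Z' []]] := dialogue_eta dd (n := n.+1);
  rewrite ?(eta_dom En) // En => -[-> _].
Qed.

(** In rule D13 and in the attack and defence rules the earlier moves keep their
status, so only the conditions on the last move have to be checked. *)
Lemma node_rcons phi l p e m Z :
  node phi l ->
  p = (if odd (size l) then Opponent else Proponent) ->
  m < size l -> odd (size l - m) ->
  match Z with
  | Attack => exists A f,
      delta (FinitePlay l) m = Some (A, Form f) /\ attack f e
  | Defend => exists k A B f c,
      [/\ eta (FinitePlay l) m = Some (k, Attack),
          delta (FinitePlay l) k = Some (A, Form f),
          delta (FinitePlay l) m = Some (B, c) & response f c e]
  end ->
  (forall a, p = Proponent -> e = Form (Atom a) ->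
     exists n, delta (FinitePlay l) n = Some (Opponent, Form (Atom a))) ->
  (Z = Attack -> ~~ odd m ->
     forall n, eta (FinitePlay l) n <> Some (m, Attack)) ->
  node phi (rcons l (Move (p, e) (Some (m, Z)))).
Proof.
move=> nl pE ml odd_m rule atom_rule once.
set x := Move _ _; have ext := @extends_rcons l x.
have l0 := node_size nl; have [dd d10 d13] := nl.
have dx : delta (FinitePlay (rcons l x)) (size l) = Some (p, e).
  by rewrite delta_last.
have ex : eta (FinitePlay (rcons l x)) (size l) = Some (m, Z).
  by rewrite eta_last.
have old := @dom_old l x.
have dE n nsl := esym (@delta_at _ _ n ext nsl).
have eE n nsl := esym (@eta_at _ _ n ext nsl).
split; first split.
- by rewrite dE ?(dialogue_opening dd).
- by rewrite eE ?(dialogue_eta0 dd).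
- move=> n n0 dn; case: (n =P size l) => [->|/(old _ dn) nsl].
    by exists m, Z.
  by rewrite eE //; apply: (dialogue_eta dd) => //; rewrite dom_finite.
- move=> n A c Dn; case: (n =P size l) => [E|/(old _ (delta_dom Dn)) nsl].
    by move: Dn; rewrite E dx => -[<- _].
  by rewrite dE // in Dn; apply: (dialogue_turns dd) Dn.
- move=> n m' En; case: (n =P size l) => [E|/(old _ (eta_dom En)) nsl].
    move: En; rewrite E ex => -[<- ZE]; split=> //.
    move: rule; rewrite ZE => -[A [f [Dm fe]]].
    exists A, p, f, e; split=> //; first by rewrite dE.
    by case=> a fE; rewrite fE in fe; inversion fe.
  rewrite eE // in En; have [om [A [B [f [c [Dm Nf Dn fc]]]]]] :=
    dialogue_attack dd En.
  by split=> //; exists A, B, f, c; split=> //; apply: (extends_delta ext).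
- move=> n m' En; case: (n =P size l) => [E|/(old _ (eta_dom En)) nsl].
    move: En; rewrite E ex => -[<- ZE]; split=> //.
    move: rule; rewrite ZE => -[k [A [B [f [c [Em Dk Dm fce]]]]]].
    exists k; split; first exact: extends_eta ext Em.
    by exists A, B, p, f, c, e; split=> //; apply: (extends_delta ext).
  rewrite eE // in En.
  have [om [k [Em [A [B [C [f [c [r [Dk Dm Dn fcr]]]]]]]]]] :=
    dialogue_defend dd En.
  split=> //; exists k; split; first exact: extends_eta ext Em.
  by exists A, B, C, f, c, r; split=> //; apply: (extends_delta ext).
- move=> n a Dn; case: (n =P size l) => [E|/(old _ (delta_dom Dn)) nsl].
    move: Dn; rewrite E dx => -[pP eA]; have [i Di] := atom_rule a pP eA.
    exists i; split; last exact: extends_delta ext Di.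
    by have := delta_dom Di; rewrite dom_finite.
  rewrite dE // in Dn; have [i [lt Di]] := d10 _ _ Dn.
  by exists i; split=> //; apply: extends_delta ext Di.
- have fresh n m' : ~~ odd m' -> n < size l ->
      eta (FinitePlay (rcons l x)) n = Some (m', Attack) ->
      (m', Attack) <> (m, Z).
    move=> em nsl; rewrite eE // => En [mE ZE].
    by rewrite mE in em En; apply: once (esym ZE) em _ En.
  move=> m' n n' em En En'.
  case: (n =P size l) => [E|/(old _ (eta_dom En)) nsl];
  case: (n' =P size l) => [E'|/(old _ (eta_dom En')) nsl'].
  + by rewrite E E'.
  + by case: (fresh _ _ em nsl' En'); rewrite E ex in En; case: En => -> ->.
  + by case: (fresh _ _ em nsl En); rewrite E' ex in En'; case: En' => -> ->.
  + by rewrite eE // in En; rewrite eE // in En'; apply: d13 em En En'.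
Qed.

(** * From strategies to derivations *)

Lemma subtree_prefix phi s l t :
  rooted_subtree phi s -> 0 < size l -> s (l ++ t) -> s l.
Proof.
move=> sub l0; elim/last_ind: t => [|t x IH]; first by rewrite cats0.
rewrite -rcons_cat => slt; apply: IH.
have child_ltx : child (l ++ t) (rcons (l ++ t) x) by exists x.
apply: (subtree_closed sub _ child_ltx slt).
apply: truncated_node (subtree_node sub slt) _ (@extends_rcons _ _).
by rewrite size_cat ltn_addr.
Qed.

(** Bar induction on a winning strategy.  If [Q] failed at a node, dependent
choice would give an infinite sequence of nodes, each a child of the previous
one; their initial segments form a branch, which is not a finite play and so
is not won by P. *)
Lemma strategy_ind phi s (Q : seq (move atom) -> Prop) :
  N_winning_strategy phi s ->
  (forall l, s l -> (forall x, s (rcons l x) -> Q (rcons l x)) -> Q l) ->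
  forall l, s l -> Q l.
Proof.
move=> win_s step l0 sl0; apply: NNPP => NQ0.
have sub := strategy_subtree win_s.
pose isbad l := s l /\ ~ Q l; pose bad := sig isbad.
have [next nextP] : exists next : bad -> bad,
    forall u, exists x, sval (next u) = rcons (sval u) x.
  apply: (functional_choice (fun u v => exists x, sval v = rcons (sval u) x)).
  move=> [l [sl NQ]]; apply: NNPP => no_next.
  apply: (NQ); apply: step => // x sx.
  by apply: NNPP => NQx; case: no_next; exists (exist isbad _ (conj sx NQx)), x.
pose u0 : bad := exist isbad l0 (conj sl0 NQ0).
pose L n := sval (iter n next u0).
have sL n : s (L n) by rewrite /L; case: (iter _ _ _) => l [].
have sizeL n : n < size (L n).
  elim: n => [|n]; first exact: node_size (subtree_node sub (sL 0)).
  by have [x] := nextP (iter n next u0); rewrite /L /= => ->;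
    rewrite size_rcons.
have Lmono n m : n <= m -> extends (FinitePlay (L n)) (FinitePlay (L m)).
  move=> /subnK <-; elim: (m - n) => [|i IH] //.
  apply: extends_trans IH _; have [x E] := nextP (iter (i + n) next u0).
  by rewrite /L addSn /= E; apply: extends_rcons.
pose b l := 0 < size l /\ exists n, extends (FinitePlay l) (FinitePlay (L n)).
have bs l : b l -> s l.
  move=> [l_gt0 [n /extends_cat[t E]]].
  by have := sL n; rewrite E; apply: subtree_prefix sub l_gt0.
have bL n : b (L n) by split; [apply: leq_ltn_trans (sizeL n) | exists n].
have [d [bd [_ [k domk] _]]] : exists d, branch_play b d /\ P_wins phi d.
  apply: (strategy_branches win_s); split.
    split=> //.
      split=> //; exists 0; apply/extends_cat.
      exact: node_root (subtree_node sub (sL 0)).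
    move=> l l' [_ [n ext]] [_ [n' ext']].
    apply: (@extends_comparable _ _ (FinitePlay (L (maxn n n')))).
      exact: extends_trans ext (Lmono _ _ (leq_maxl n n')).
    exact: extends_trans ext' (Lmono _ _ (leq_maxr n n')).
  move=> b' [b's _ b'chain] bb' l b'l; split.
    exact: node_size (subtree_node sub (b's _ b'l)).
  (* [L n] has more than [n] moves, so [L (size l)] is too long to be an
     initial segment of [l]. *)
  exists (size l).
  case: (b'chain _ _ b'l (bb' _ (bL (size l)))) => // /extends_cat[t lE].
  by have := congr1 size lE; have := sizeL (size l); rewrite size_cat; lia.
have [_ ext] := (bd (L k.*2.+1)).1 (bL _).
have := domk k.*2.+1; rewrite ltnn /dom -(extends_at ext) // -/(dom _ _).
by rewrite dom_finite sizeL.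
Qed.

Definition asserted l f :=
  exists n, delta (FinitePlay l) n = Some (Opponent, Form f).

(** Only attacks by O count, since these are the ones that P answers. *)
Definition answer l f :=
  exists m i A g c,
    [/\ eta (FinitePlay l) m = Some (i, Attack),
        delta (FinitePlay l) i = Some (A, Form g),
        delta (FinitePlay l) m = Some (Opponent, c) & response g c (Form f)].

Lemma asserted_rcons l x f :
  asserted (rcons l x) f ->
  asserted l f \/ expression x = (Opponent, Form f).
Proof.
move=> [n Dn]; case: (n =P size l) => [E|/(dom_old (delta_dom Dn)) nl].
  by right; move: Dn; rewrite E delta_last => -[].
by left; exists n; rewrite (delta_at (@extends_rcons l x)).
Qed.

Lemma answer_rcons phi l x f :
  node phi l -> node phi (rcons l x) -> answer (rcons l x) f ->
  answer l f \/
  exists i A g e, [/\ reference x = Some (i, Attack),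
    delta (FinitePlay l) i = Some (A, Form g), expression x = (Opponent, e) & 
    response g e (Form f)].
Proof.
move=> nl nx [m [i [A [g [c [Em Di Dm r]]]]]]; have ext := @extends_rcons l x.
have im := node_ref nx Em.
case: (m =P size l) => [E|/(dom_old (delta_dom Dm)) ml].
  right; exists i, A, g, c; rewrite E eta_last delta_last in Em Dm.
  by case: Dm => Dm; split=> //; rewrite (delta_at ext) // -E.
left; exists m, i, A, g, c.
by rewrite (eta_at ext) // !(delta_at ext) //; apply: ltn_trans ml.
Qed.

(** No earlier move refers to the last one, so D13 does not stop O from
attacking it. *)
Lemma opponent_attack_node phi l A f e :
  node phi l -> odd (size l) ->
  delta (FinitePlay l) (size l).-1 = Some (A, Form f) -> attack f e ->
  node phi (rcons l (Move (Opponent, e) (Some ((size l).-1, Attack)))).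
Proof.
move=> nl odd_l Dl fe; have l0 := node_size nl.
apply: node_rcons => //.
- by rewrite odd_l.
- by rewrite prednK.
- by have -> : size l - (size l).-1 = 1 by lia.
- by exists A, f.
- move=> _ _ n En; have := node_ref nl En; have := eta_dom En.
  by rewrite dom_finite; lia.
Qed.

(** If P has made an attack that has an answer, then O can give this answer in
every later move, which contradicts the finiteness of the branches. *)
Lemma strategy_no_answerable_attack phi s l n i A B g c r :
  N_winning_strategy phi s -> s l -> ~~ odd n ->
  eta (FinitePlay l) n = Some (i, Attack) ->
  delta (FinitePlay l) i = Some (A, Form g) ->
  delta (FinitePlay l) n = Some (B, c) -> ~ response g c r.
Proof.
move=> win_s sl even_n En Di Dn gcr.
have sub := strategy_subtree win_s.
move: l sl En Di Dn; apply: (strategy_ind win_s) => l sl IH En Di Dn.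
have IHx x : ~ s (rcons l x).
  by have ext := @extends_rcons l x; move/IH; apply;
    [apply: extends_eta ext En | apply: extends_delta ext Di
    | apply: extends_delta ext Dn].
have nl := subtree_node sub sl; have l0 := node_size nl.
have [odd_l | even_l] := boolP (odd (depth l)).
  by have [_ [[[x ->] /IHx]]] := strategy_odd win_s sl odd_l.
have odd_l : odd (size l) by rewrite -(prednK l0) /= even_l.
have nsl : n < size l by rewrite -dom_finite (eta_dom En).
pose y := Move (Opponent, r) (Some (n, Defend)).
have ny : node phi (rcons l y).
  apply: node_rcons => //; first by rewrite odd_l.
    by rewrite oddB ?odd_l // ltnW.
  by exists i, A, B, g, c.
apply: (IHx y); apply/(strategy_even win_s sl even_l) => //.
by exists y.
Qed.

(** Bar induction along the moves of the strategy, where it is enough to let O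
always attack the assertion that P has just made: the sets [asserted l] and
[answer l] at the nodes in which P is to move are then winning. *)
Lemma valid_derivable phi : N_valid phi -> derivable phi.
Proof.
move=> [s win_s]; have sub := strategy_subtree win_s.
pose Q l :=
  if odd (depth l) then win (asserted l) (answer l)
  else forall f e,
    delta (FinitePlay l) (size l).-1 = Some (Proponent, Form f) ->
    attack f e ->
    win (fun g => asserted l g \/ e = Form g)
        (fun g => answer l g \/ response f e (Form g)).
suff QP : forall l, s l -> Q l.
  have := QP _ (subtree_root sub); rewrite /Q /= => Q0.
  have n0 := subtree_node sub (subtree_root sub); split.
    case=> a phiE; have [_ d10 _] := n0.
    by have [|m []] := d10 0 a; rewrite ?phiE.
  have silent g : ~ asserted (root_node phi) g.
    by move=> [[|n] // /delta_dom]; rewrite dom_finite.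
  move=> e phi_e; apply: (win_discard (Q0 _ _ erefl phi_e)).
    move=> f [[[m [i [A [g [c [Em _ _ _]]]]]]|r]|[/silent //|->]].
    + by have := eta_dom Em; rewrite dom_finite; case: m Em.
    + by left; left.
    + by left; right.
  by move=> a [/silent|].
apply: (strategy_ind win_s) => l sl IH.
have nl := subtree_node sub sl; have l0 := node_size nl.
rewrite /Q; case: ifPn => [odd_l | even_l].
  have [_ [[[x ->] sx] _]] := strategy_odd win_s sl odd_l.
  have even_l : ~~ odd (size l) by rewrite -(prednK l0) /= odd_l.
  have nx := subtree_node sub sx; have [dx d10 d13] := nx.
  have ext := @extends_rcons l x.
  have := IH x sx; rewrite /Q /depth size_rcons /= (negPf even_l) delta_last.
  have [||m [Z [Ex ml]]] := dialogue_eta dx (n := size l);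
    rewrite ?dom_finite ?size_rcons //.
  case xE: (expression x) => [p w].
  have Dx : delta (FinitePlay (rcons l x)) (size l) = Some (p, w).
    by rewrite delta_last xE.
  have pE : p = Proponent.
    by rewrite (dialogue_turns dx Dx) (negPf even_l).
  have opp i A c : odd (size l - i) -> i < size l ->
      delta (FinitePlay (rcons l x)) i = Some (A, c) ->
      delta (FinitePlay l) i = Some (Opponent, c).
    move=> odd_i il Di; rewrite (delta_at ext) // Di.
    rewrite (dialogue_turns dx Di).
    by move: odd_i; rewrite oddB ?(negPf even_l) 1?ltnW //= => ->.
  have [f wE fav] :
      exists2 f, w = Form f & available (asserted l) (answer l) f.
    case: Z Ex => Ex.
      have [odd_m [A [B [g [c [Dm _ Dx' gc]]]]]] := dialogue_attack dx Ex.
      have := strategy_no_answerable_attack win_s sx even_l Ex Dm Dx'.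
      have Om := opp _ _ _ odd_m ml Dm.
      rewrite Dx in Dx'; case: Dx' => _ ->.
      (* Only the last rule, the attack on a negation, has no answer. *)
      case: gc Om => [h k|h k|h k|h k|h] Om no_answer;
        try by case: (no_answer (Form h)); constructor.
      - by case: (no_answer (Form k)); constructor.
      - by case: (no_answer (Form k)); constructor.
      by exists h => //; right; exists m.
    have [odd_m [i [Em [A [B [C [g [c [r [Di Dm Dx' gcr]]]]]]]]]] :=
      dialogue_defend dx Ex.
    rewrite Dx in Dx'; case: Dx' => _ wE.
    have [f rE] : exists f, r = Form f by case: gcr => h k; eexists.
    exists f; first by rewrite wE.
    left; exists m, i, A, g, c; rewrite -rE.
    rewrite (eta_at ext) // (opp _ _ _ odd_m ml Dm) (delta_at ext) //.
    exact: ltn_trans (node_ref nx Em) ml.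
  rewrite wE pE => /(_ f _ erefl) w_f.
  apply: (@win_assert _ _ f fav).
    move=> a fE; have [|i [il Di]] := d10 (size l) a.
      by rewrite Dx wE pE fE.
    by exists i; rewrite fE (delta_at ext).
  have mono_asserted g : asserted (rcons l x) g -> asserted l g.
    by move/asserted_rcons=> [//|]; rewrite xE pE.
  have mono_answer g : answer (rcons l x) g -> answer l g.
    move/(answer_rcons nl nx) => [//|[i [A [h [c [_ _]]]]]].
    by rewrite xE pE.
  move=> e /w_f we; apply: (win_discard we).
    move=> g [[/mono_answer ?|?]|[/mono_asserted ?|?]]; left.
    - by left; left.
    - by left; right.
    - by right; left.
    - by right; right.
  by move=> a [/mono_asserted ?|?]; [left | right].
have odd_l : odd (size l) by rewrite -(prednK l0) /= even_l.
move=> f e Dl fe.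
pose y := Move (Opponent, e) (Some ((size l).-1, Attack)).
have ny : node phi (rcons l y) := opponent_attack_node nl odd_l Dl fe.
have sy : s (rcons l y).
  by apply/(strategy_even win_s sl even_l) => //; exists y.
have := IH y sy; rewrite /Q /depth size_rcons /= odd_l => w.
have mono_asserted g : asserted (rcons l y) g -> asserted l g \/ e = Form g.
  by move/asserted_rcons=> [|[->]]; [left | right].
apply: (win_discard w) => [g|a /mono_asserted //].
case=> [gans|/mono_asserted ?]; left.
  left; case: (answer_rcons nl ny gans) => [|[i [A [h [c [[<-]]]]]]].
    by left.
  by rewrite Dl => -[_ ->] [->]; right.
by right.
Qed.

(** * From derivations to strategies *)

(** A branch of a well-founded tree has a last node [m], and the branch consists
of the initial segments of [m].  In a tree that keeps all moves of O and always
gives P a move, such an [m] is a leaf at even depth, and O has no move there. *)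
Lemma finite_branch_won phi s :
  rooted_subtree phi s ->
  (forall Q : seq (move atom) -> Prop,
     (forall l, s l -> (forall x, s (rcons l x) -> Q (rcons l x)) -> Q l) ->
     forall l, s l -> Q l) ->
  (forall l, s l -> odd (depth l) -> exists x, s (rcons l x)) ->
  (forall l x, s l -> ~~ odd (depth l) -> node phi (rcons l x) ->
     s (rcons l x)) ->
  forall b, branch phi s b -> exists d, branch_play b d /\ P_wins phi d.
Proof.
move=> sub s_ind s_odd s_even b [[bs broot bchain] bmax].
have size_s l : s l -> 0 < size l by move/(subtree_node sub)/node_size.
have b_prefix l l' :
    0 < size l -> extends (FinitePlay l) (FinitePlay l') -> b l' -> b l.
  move=> l0 ext bl'.
  pose b' l1 := 0 < size l1 /\
    exists2 l2, b l2 & extends (FinitePlay l1) (FinitePlay l2).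
  apply: (bmax b'); last by split=> //; exists l'.
    split.
    - move=> l1 [l1_gt0 [l2 /bs sl2 /extends_cat[t l2E]]].
      by rewrite l2E in sl2; apply: subtree_prefix sub l1_gt0 sl2.
    - by split=> //; exists (root_node phi).
    - move=> l1 l2 [_ [l1' b1 e1]] [_ [l2' b2 e2]].
      case: (bchain _ _ b1 b2) => e12.
        exact: extends_comparable (extends_trans e1 e12) e2.
      exact: extends_comparable e1 (extends_trans e2 e12).
  by move=> l1 b1; split; [apply/size_s/bs | exists l1].
have [m bm mlast] : exists2 m, b m & forall x, ~ b (rcons m x).
  move: (broot); move: (bs _ broot); move: (root_node phi).
  apply: s_ind => l sl IH bl; case: (classic (exists x, b (rcons l x))).
    by move=> [x bx]; apply: (IH x) => //; apply: bs.
  by move=> no_x; exists l => // x bx; case: no_x; exists x.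
have sm := bs _ bm; have m0 := size_s _ sm.
have bm_ext l : b l -> extends (FinitePlay l) (FinitePlay m).
  move=> bl; case: (bchain _ _ bl bm) => // /extends_cat[[|x t] lE].
    by rewrite lE cats0.
  case: (mlast x); apply: b_prefix bl; first by rewrite size_rcons.
  by apply/extends_cat; exists t; rewrite lE cat_rcons.
have leaf x : ~ s (rcons m x).
  move=> sx; case: (mlast x).
  apply: (bmax (fun l => b l \/ l = rcons m x)); [split | by left | by right].
  - by move=> l [/bs|->].
  - by left.
  - have ext := @extends_rcons m x.
    move=> l l' [bl|->] [bl'|->]; first exact: bchain.
    + by left; apply: extends_trans (bm_ext _ bl) ext.
    + by right; apply: extends_trans (bm_ext _ bl') ext.
    + by left.
have even_m : ~~ odd (depth m).
  by apply/negP => /(s_odd _ sm)[x /leaf].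
exists (FinitePlay m); split.
  move=> l; split=> [bl|[l0 ext]]; last exact: b_prefix bm.
  by split; [apply/size_s/bs | apply: bm_ext].
split; first exact: subtree_node sub _ sm.
  exists (depth m)./2 => n; rewrite dom_finite even_halfK //.
  by rewrite -[in LHS](prednK m0) ltnS.
move=> [d [nd [ext not_ext]]].
have long : dom d (size m).
  apply: NNPP => short; case: not_ext => n x dn.
  rewrite (extends_at ext) // ltnNge; apply/negP => mn.
  by case: short; apply: dom_down mn _; rewrite /dom dn.
move: long; rewrite /dom; case E: move_at => [x|] // _.
apply: (leaf x); apply: s_even => //.
apply: truncated_node nd _ _; first by rewrite size_rcons.
move=> n y; case: (n =P size m) => [->|nm].
  by rewrite move_at_rcons => -[<-].
move=> Dn; apply: ext; rewrite -Dn; apply: extends_at (@extends_rcons _ _) _.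
by apply: (@dom_old m x) nm; rewrite /dom Dn.
Qed.

(** [wins_with phi reply l] says that P, who has just moved, wins from [l] in
finitely many moves by always playing [reply l'] at the play [l'] reached. *)
Inductive wins_with phi reply l : Prop :=
| wins_with_replies :
    node phi l ->
    (forall y, node phi (rcons l y) ->
       wins_with phi reply (rcons (rcons l y) (reply (rcons l y)))) ->
    wins_with phi reply l.

Lemma eq_wins_with phi reply reply' l :
  (forall x t, reply (l ++ x :: t) = reply' (l ++ x :: t)) ->
  wins_with phi reply l -> wins_with phi reply' l.
Proof.
move=> eq_reply w.
elim: w eq_reply.
move=> {}l nl _ IH eq_reply.
apply: (wins_with_replies nl) => y ny.
have E := eq_reply y [::]; rewrite cats1 in E.
by rewrite -E; apply: IH => // x t; rewrite !cat_rcons eq_reply.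
Qed.

(** A reply function sees the whole play, so the ones chosen for the different
moves [y] of O can be glued together: look up which [y] was played at position
[size l]. *)
Lemma combine_replies phi l :
  node phi l ->
  (forall y, node phi (rcons l y) ->
     exists x reply, wins_with phi reply (rcons (rcons l y) x)) ->
  exists reply, wins_with phi reply l.
Proof.
move=> nl wins_y; pose x0 : move atom := Move (Proponent, Form phi) None.
have [F FP] : exists F : move atom ->
      move atom * (seq (move atom) -> move atom),
    forall y, node phi (rcons l y) ->
      wins_with phi (F y).2 (rcons (rcons l y) (F y).1).
  apply: (functional_choice (fun y p => node phi (rcons l y) ->
    wins_with phi p.2 (rcons (rcons l y) p.1))) => y.
  case: (classic (node phi (rcons l y))) => [/wins_y[x [reply w]]|no_y].
    by exists (x, reply).
  by exists (x0, fun=> x0).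
pose reply l' := let y := nth x0 l' (size l) in
  if size l' == (size l).+1 then (F y).1 else (F y).2 l'.
exists reply; apply: wins_with_replies nl _ => y /FP; set x := reply _.
have -> : (F y).1 = x.
  by rewrite /x /reply size_rcons eqxx nth_rcons ltnn eqxx.
apply: eq_wins_with => z t.
rewrite /reply !cat_rcons nth_cat ltnn subnn /= ifN // size_cat /=.
by lia.
Qed.

Inductive follows phi reply : seq (move atom) -> Prop :=
| follows_root : follows phi reply (root_node phi)
| follows_opponent l y :
    follows phi reply l -> odd (size l) -> node phi (rcons l y) ->
    follows phi reply (rcons l y)
| follows_reply l :
    follows phi reply l -> ~~ odd (size l) ->
    follows phi reply (rcons l (reply l)).

Lemma follows_rcons phi reply l x :
  0 < size l -> follows phi reply (rcons l x) ->
  follows phi reply l /\ (~~ odd (size l) -> x = reply l).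
Proof.
move=> l0 fx; inversion fx as [E|l' y fl odd_l ny E|l' fl even_l E].
- by case: l l0 E {fx} => // z [|].
- by case: (rcons_inj E) fl odd_l => -> _ fl ->.
- by case: (rcons_inj E) fl => -> <- fl.
Qed.

Lemma follows_wins phi reply l :
  wins_with phi reply (root_node phi) -> follows phi reply l ->
  node phi l /\
  wins_with phi reply (if odd (size l) then l else rcons l (reply l)).
Proof.
move=> w; elim=> {l} [|l y _ IH odd_l ny|l _ IH even_l].
- by split=> //; case: w.
- rewrite size_rcons /= odd_l; case: IH => _.
  by rewrite odd_l => -[_ /(_ y ny)].
- rewrite size_rcons /= even_l; case: IH => _; rewrite (negPf even_l) => wl.
  by split=> //; case: wl.
Qed.

Lemma reply_strategy phi reply :
  wins_with phi reply (root_node phi) ->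
  N_winning_strategy phi (follows phi reply).
Proof.
move=> w.
have nodeP l : follows phi reply l -> node phi l.
  by case/(follows_wins w).
have size_gt0 l : follows phi reply l -> 0 < size l by move/nodeP/node_size.
have oddE l : follows phi reply l -> odd (depth l) = ~~ odd (size l).
  by move/size_gt0=> l0; rewrite -(prednK l0) /= negbK.
have sub : rooted_subtree phi (follows phi reply).
  split=> //; first exact: follows_root.
  by move=> l _ /node_size l0 [x ->] /(follows_rcons l0)[].
have odd_child l : follows phi reply l -> odd (depth l) ->
    follows phi reply (rcons l (reply l)).
  by move=> fl; rewrite oddE // => even_l; apply: follows_reply.
have even_child l x : follows phi reply l -> ~~ odd (depth l) ->
    node phi (rcons l x) -> follows phi reply (rcons l x).
  by move=> fl; rewrite oddE // negbK => odd_l; apply: follows_opponent.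
split=> //.
- apply: finite_branch_won => //; last first.
    by move=> l fl odd_l; exists (reply l); apply: odd_child.
  move=> Q step.
  have Qodd l :
      wins_with phi reply l -> odd (size l) -> follows phi reply l -> Q l.
    elim=> {}l nl _ IH odd_l fl; apply: (step) => // y fy.
    apply: (step) => // x fx.
    have [_ xE] := follows_rcons (size_gt0 _ fy) fx.
    rewrite xE in fx *; last by rewrite size_rcons /= odd_l.
    by apply: IH (nodeP _ fy) _ fx; rewrite !size_rcons /= odd_l.
  move=> l fl; have [_] := follows_wins w fl.
  case: ifPn => [odd_l wl|even_l wl]; first exact: Qodd.
  apply: (step) => // x fx; have [_ xE] := follows_rcons (size_gt0 _ fl) fx.
  by rewrite xE // in fx *; apply: Qodd => //; rewrite size_rcons.
- move=> l fl odd_l; exists (rcons l (reply l)); split.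
    by split; [exists (reply l) | apply: odd_child].
  move=> _ [[x ->] fx]; have [_ ->] := follows_rcons (size_gt0 _ fl) fx => //.
  by rewrite -oddE.
- by move=> l fl even_l _ [x ->]; split=> [/nodeP|] //; apply: even_child.
Qed.

(** The shape of the plays against which P needs a reply: P attacks negations
only, and this forces O to attack the preceding move each time. *)
Record linear l : Prop := {
  linear_odd n m Z : odd n -> eta (FinitePlay l) n = Some (m, Z) ->
    (m, Z) = (n.-1, Attack);
  linear_even n m A f : ~~ odd n -> eta (FinitePlay l) n = Some (m, Attack) ->
    delta (FinitePlay l) m = Some (A, Form f) -> exists g, f = Neg g }.

Lemma linear_rcons phi l x m Z :
  node phi l -> linear l -> m < size l -> reference x = Some (m, Z) ->
  (odd (size l) -> (m, Z) = ((size l).-1, Attack)) ->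
  (~~ odd (size l) -> Z = Attack -> exists A g,
     delta (FinitePlay l) m = Some (A, Form (Neg g))) ->
  linear (rcons l x).
Proof.
move=> nl [lin_odd lin_even] ml xE x_odd x_even.
have ext := @extends_rcons l x.
split=> n m' => [Z' odd_n|A f even_n] En.
  case: (n =P size l) => [nE|/(dom_old (eta_dom En)) nsl].
    by move: En odd_n; rewrite nE eta_last xE => -[<- <-].
  by rewrite -(eta_at ext) // in En; apply: lin_odd En.
case: (n =P size l) => [nE|/(dom_old (eta_dom En)) nsl].
  move: En even_n; rewrite nE eta_last xE => -[<- ZE] even_l.
  have [B [g Dm]] := x_even even_l ZE.
  by rewrite (extends_delta ext Dm) => -[_ <-]; exists g.
rewrite -(eta_at ext) // in En.
rewrite -(delta_at ext) ?(ltn_trans (node_ref nl En)) //.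
exact: lin_even En.
Qed.

(** O cannot defend, because P has attacked negations only, and all assertions
of P but the last have been attacked, so D13 leaves only the last one. *)
Lemma linear_opponent phi l y A f :
  node phi l -> linear l -> odd (size l) ->
  delta (FinitePlay l) (size l).-1 = Some (A, Form f) ->
  node phi (rcons l y) ->
  exists2 e, y = Move (Opponent, e) (Some ((size l).-1, Attack)) & attack f e.
Proof.
move=> nl [lin_odd lin_even] odd_l Dl ny; have l0 := node_size nl.
have [dl _ _] := nl; have [dy _ d13] := ny.
have ext := @extends_rcons l y.
have [||m [Z [Ey ml]]] := dialogue_eta dy (n := size l);
  rewrite ?dom_finite ?size_rcons //.
have even_m : odd (size l - m) -> ~~ odd m by rewrite oddB 1?ltnW // odd_l.
case yE: y => [[p e] ref].
have Dy : delta (FinitePlay (rcons l y)) (size l) = Some (p, e).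
  by rewrite delta_last yE.
have pE := dialogue_turns dy Dy; rewrite odd_l in pE.
have refE : ref = Some (m, Z) by move: Ey; rewrite eta_last yE.
case: Z Ey refE => Ey refE; last first.
  have [/even_m em [i [Em [B [C [D [g [c [r [Di Dm _ gcr]]]]]]]]]] :=
    dialogue_defend dy Ey.
  rewrite -(eta_at ext) // in Em.
  rewrite -(delta_at ext) in Di; last exact: ltn_trans (node_ref nl Em) ml.
  by have [h gE] := lin_even _ _ _ _ em Em Di; rewrite gE in gcr; inversion gcr.
have [/even_m em [B [C [g [c [Dm _ Dy' gc]]]]]] := dialogue_attack dy Ey.
have mE : m = (size l).-1.
  (* Otherwise move [m.+1] is one of O, hence an earlier attack on [m]. *)
  apply: NNPP => m_old; have odd_m1 : odd m.+1 by [].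
  have ml1 : m.+1 < size l by lia.
  have [||m' [Z' [Em1 _]]] := dialogue_eta dl (n := m.+1);
    rewrite ?dom_finite //.
  have [m'E Z'E] := lin_odd _ _ _ odd_m1 Em1; rewrite m'E Z'E /= in Em1.
  by have := d13 _ _ _ em Ey (extends_eta ext Em1); lia.
move: Dm; rewrite -(delta_at ext) // mE Dl => -[_ gE].
move: Dy'; rewrite Dy => -[_ cE].
by exists e; rewrite ?refE ?pE ?mE // gE cE.
Qed.

Lemma proponent_move phi l f :
  node phi l -> ~~ odd (size l) ->
  available (asserted l) (answer l) f ->
  (forall a, f = Atom a -> asserted l f) ->
  exists x m Z, [/\ x = Move (Proponent, Form f) (Some (m, Z)), m < size l,
    node phi (rcons l x) &
    Z = Attack -> exists A g, delta (FinitePlay l) m = Some (A, Form (Neg g))].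
Proof.
move=> nl even_l fav fat; have [dl _ _] := nl.
have odd_sub m c : delta (FinitePlay l) m = Some (Opponent, c) ->
    [/\ odd m, m < size l & odd (size l - m)].
  move=> Dm; have ml : m < size l by rewrite -dom_finite (delta_dom Dm).
  have odd_m : odd m by have := dialogue_turns dl Dm; case: odd.
  by split=> //; rewrite oddB 1?ltnW // odd_m (negPf even_l).
have atom_rule a : Proponent = Proponent -> Form f = Form (Atom a) ->
    exists n, delta (FinitePlay l) n = Some (Opponent, Form (Atom a)).
  by move=> _ [fE]; rewrite -fE; apply: fat fE.
case: fav => [[m [i [A [g [c [Em Di Dm r]]]]]]|[m Dm]].
  have [odd_m ml odd_lm] := odd_sub _ _ Dm.
  exists (Move (Proponent, Form f) (Some (m, Defend))), m, Defend; split=> //.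
  apply: node_rcons => //; first by rewrite (negPf even_l).
  by exists i, A, Opponent, g, c.
have [odd_m ml odd_lm] := odd_sub _ _ Dm.
exists (Move (Proponent, Form f) (Some (m, Attack))), m, Attack; split=> //.
  apply: node_rcons => //; first by rewrite (negPf even_l).
    by exists Opponent, (Neg f); split=> //; apply: attack_neg.
  by move=> _; rewrite odd_m.
by move=> _; exists Opponent, f.
Qed.

Lemma asserted_extends l l' f :
  extends (FinitePlay l) (FinitePlay l') -> asserted l f -> asserted l' f.
Proof. by move=> ext [n Dn]; exists n; apply: extends_delta ext Dn. Qed.

Lemma answer_extends l l' f :
  extends (FinitePlay l) (FinitePlay l') -> answer l f -> answer l' f.
Proof.
move=> ext [m [i [A [g [c [Em Di Dm r]]]]]]; exists m, i, A, g, c; split=> //.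
- exact: extends_eta ext Em.
- exact: extends_delta ext Di.
- exact: extends_delta ext Dm.
Qed.

Lemma wins_after_attack phi l A f :
  node phi l -> linear l -> odd (size l) ->
  delta (FinitePlay l) (size l).-1 = Some (A, Form f) ->
  (forall e l', attack f e -> node phi l' -> linear l' -> ~~ odd (size l') ->
     extends (FinitePlay l) (FinitePlay l') ->
     (forall g, e = Form g -> asserted l' g) ->
     (forall g, response f e (Form g) -> answer l' g) ->
     exists x reply, wins_with phi reply (rcons l' x)) ->
  exists reply, wins_with phi reply l.
Proof.
move=> nl lin odd_l Dl win_e; apply: combine_replies => // y ny.
have [e yE fe] := linear_opponent nl lin odd_l Dl ny.
have ext := @extends_rcons l y; have l0 := node_size nl.
have Dy : delta (FinitePlay (rcons l y)) (size l) = Some (Opponent, e).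
  by rewrite delta_last yE.
have Ey : eta (FinitePlay (rcons l y)) (size l) = Some ((size l).-1, Attack).
  by rewrite eta_last yE.
apply: (win_e e) => //.
- apply: (@linear_rcons _ _ _ (size l).-1 Attack nl lin).
  + by rewrite prednK.
  + by rewrite yE.
  + by [].
  + by rewrite odd_l.
- by rewrite size_rcons /= odd_l.
- by move=> g eE; exists (size l); rewrite Dy eE.
- move=> g r; exists (size l), (size l).-1, A, f, e; split=> //.
  exact: extends_delta ext Dl.
Qed.

(** P asserts in the play what P asserts in the derivation.  The play may offer
P more than [G] and [D] do, hence the inclusions. *)
Lemma wins_of_win phi (G D : formula atom -> Prop) l :
  win G D -> node phi l -> linear l -> ~~ odd (size l) ->
  (forall g, G g -> asserted l g) -> (forall g, D g -> answer l g) ->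
  exists x reply, wins_with phi reply (rcons l x).
Proof.
move=> w; elim: w l => {}G {}D f fav fat _ IH l nl lin even_l GA DA.
have [||x [m [Z [xE ml nx xneg]]]] := proponent_move nl even_l (f := f).
- by case: fav => [/DA|/GA] ?; [left | right].
- by move=> a /fat/GA.
have ext := @extends_rcons l x; exists x.
apply: (@wins_after_attack _ _ Proponent f) => //.
- apply: (linear_rcons nl lin ml); first by rewrite xE.
    by rewrite (negPf even_l).
  by move=> _.
- by rewrite size_rcons.
- by rewrite size_rcons delta_last xE.
move=> e l' fe nl' lin' even_l' ext' eA rA.
have ext2 := extends_trans ext ext'.
apply: (IH e fe) => // g [].
- by move/GA; apply: asserted_extends ext2.
- exact: eA.
- by move/DA; apply: answer_extends ext2.
- exact: rA.
Qed.

Lemma root_is_node phi : ~ is_atomic phi -> node phi (root_node phi).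
Proof.
move=> Nphi.
have onlyd n v : delta (FinitePlay (root_node phi)) n = Some v ->
    n = 0 /\ v = (Proponent, Form phi).
  by case: n => [|n /delta_dom]; [case=> <- | rewrite dom_finite].
have noe n : eta (FinitePlay (root_node phi)) n = None.
  by case: n => [|n] //; rewrite /eta /= onth0n.
split; first split=> //.
- by move=> [|n] //; rewrite dom_finite.
- by move=> n A e /onlyd[-> [-> _]].
- by move=> n m; rewrite noe.
- by move=> n m; rewrite noe.
- by move=> n a /onlyd[_ [E]]; case: Nphi; exists a.
- by move=> m n n' _; rewrite noe.
Qed.

Lemma derivable_valid phi : derivable phi -> N_valid phi.
Proof.
move=> [Nphi wphi]; have nroot := root_is_node Nphi.
have no_ref n : eta (FinitePlay (root_node phi)) n = None.
  by case: n => [|n] //; rewrite /eta /= onth0n.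
have lin_root : linear (root_node phi).
  by split=> [n m Z _ | n m A f _]; rewrite no_ref.
have [//|//|//|//||reply w] :=
  @wins_after_attack phi (root_node phi) Proponent phi.
  move=> e l' phi_e nl' lin' even_l' _ eA rA.
  by apply: wins_of_win (wphi e phi_e) nl' lin' even_l' eA rA.
by exists (follows phi reply); apply: reply_strategy.
Qed.

End N_dialogues.

Theorem theorem5 (atom : Type) (atom_nonempty : inhabited atom)
  (phi psi : formula atom) :
  N_valid phi -> N_valid (Imp phi psi) -> N_valid psi.
Proof.
move=> /valid_derivable dphi /valid_derivable dimp.
exact: derivable_valid (derivable_mp dphi dimp).
Qed.
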